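(* Let $m$ be a multiplicity on a category $\mathcal{C}$ that has finite multiplicity property. Then $d_m$ is a pseudo distance on the class of objects of $\mathcal{C}$. Namely, the following hold for any objects $X$, $Y$ and $Z$ of $\mathcal{C}$: (D1$'$) $d_m(X,Y)\geq 0$ and $d_m(X,X)=0$; (D2) $d_m(X,Y)=d_m(Y,X)$; (D3) $d_m(X,Z)\leq d_m(X,Y)+d_m(Y,Z)$.
   Context: The order, addition and multiplication of $\mathbb{R}$ are extended to $\mathbb{R}\cup\{\infty\}$ in the usual way, with $r\cdot\infty=\infty\cdot r=\infty\cdot\infty=\infty$ for positive real $r$, and $\log_e(\infty)=\infty$. A multiplicity $m$ on a category $\mathcal{C}$ assigns to each morphism $f:X\to Y$ an element $m(f)\in\mathbb{R}_{\geq 1}\cup\{\infty\}$ such that $m(\mathrm{id}_X)=1$ for every object $X$, and $m(g\circ f)\leq m(f)m(g)$ for all morphisms $f:X\to Y$, $g:Y\to Z$. $m(X:Y)$ is the infimum of $m(f)$ over all morphisms $f:X\to Y$; if there is no morphism from $X$ to $Y$, then $m(X:Y)=\infty$. The multiplicity distance is $d_m(X,Y)=\log_e\bigl(m(X:Y)\,m(Y:X)\bigr)\in\mathbb{R}_{\geq 0}\cup\{\infty\}$. $m$ has finite multiplicity property if $m(X:Y)\neq\infty$ for all objects $X,Y$ of $\mathcal{C}$ (i.e. for all $X,Y$ there is a morphism $f:X\to Y$ with $m(f)<\infty$). *)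

(* Defs.v *)
From mathcomp Require Import all_boot all_order all_algebra.
From mathcomp Require Import all_classical all_reals all_analysis.

Set Implicit Arguments.
Unset Strict Implicit.
Unset Printing Implicit Defensive.

Import Order.TTheory GRing.Theory Num.Theory.

Local Open Scope classical_set_scope.
Local Open Scope ring_scope.
Local Open Scope ereal_scope.

(* Objects form an arbitrary type; equality of morphisms is Leibniz equality,
   and [compm g f] is the composite of [g] after [f]. *)
Record category : Type := Category {
  obj :> Type;
  hom : obj -> obj -> Type;
  idm : forall X : obj, hom X X;
  compm : forall X Y Z : obj, hom Y Z -> hom X Y -> hom X Z;
  comp_idl : forall (X Y : obj) (f : hom X Y), compm (idm Y) f = f;
  comp_idr : forall (X Y : obj) (f : hom X Y), compm f (idm X) = f;
  comp_assoc : forall (W X Y Z : obj)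
    (h : hom Y Z) (g : hom X Y) (f : hom W X),
    compm h (compm g f) = compm (compm h g) f
}.

(* The field [mult_ge1] makes the values range over [1, +oo]; on such values
   the product of [\bar R] satisfies r * +oo = +oo * r = +oo * +oo = +oo. *)
Record multiplicity (R : realType) (C : category) : Type := Multiplicity {
  mult :> forall X Y : C, hom X Y -> \bar R;
  mult_ge1 : forall (X Y : C) (f : hom X Y), 1 <= mult f;
  mult_id : forall X : C, mult (idm X) = 1;
  mult_comp : forall (X Y Z : C) (f : hom X Y) (g : hom Y Z),
    mult (compm g f) <= mult f * mult g
}.

(* m(X : Y).  The infimum of the empty set in [\bar R] is +oo (ereal_inf0),
   the value required when there is no morphism from X to Y. *)
Definition mult_inf (R : realType) (C : category) (m : multiplicity R C)
    (X Y : C) : \bar R :=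
  ereal_inf [set m X Y f | f in [set: hom X Y]].

(* [lne] is the natural logarithm extended by lne +oo = +oo. *)
Definition mult_dist (R : realType) (C : category) (m : multiplicity R C)
    (X Y : C) : \bar R :=
  lne (mult_inf m X Y * mult_inf m Y X).

Definition finite_multiplicity_property (R : realType) (C : category)
    (m : multiplicity R C) : Prop :=
  forall X Y : C, mult_inf m X Y <> +oo.

(* A pseudo distance is real-valued: since d takes its values in [\bar R],
   this is the condition [pd_fin]. *)
Record pseudo_distance (R : realType) (T : Type) (d : T -> T -> \bar R) :
    Prop := PseudoDistance {
  pd_fin : forall X Y : T, d X Y \is a fin_num;
  pd_ge0 : forall X Y : T, 0 <= d X Y;
  pd_refl : forall X : T, d X X = 0;
  pd_sym : forall X Y : T, d X Y = d Y X;
  pd_triangle : forall X Y Z : T, d X Z <= d X Y + d Y Z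
}.

(* Main.v *)
Require Import Defs.
From mathcomp Require Import all_boot all_order all_algebra.
From mathcomp Require Import all_classical all_reals all_analysis.

(** Composition is submultiplicative for a multiplicity, and passing to the
    infimum over both factors preserves this:
    [mult_inf m X Z <= mult_inf m X Y * mult_inf m Y Z]
    ([mult_inf_triangle]).  Taking this inequality in both directions,
    multiplying the two and applying the logarithm gives the triangle
    inequality for [mult_dist m].  Symmetry is commutativity of the
    product, and the rest comes from the bound
    [1 <= mult_inf m X Y] ([mult_inf_ge1]): it makes logarithms nonnegative,
    it turns products into sums under [lne], and together with [m id = 1] it
    forces [mult_inf m X X = 1].  The finite multiplicity property, with
    this bound, makes the distance finite. *)

Set Implicit Arguments.
Unset Strict Implicit.
Unset Printing Implicit Defensive.

Import Order.TTheory GRing.Theory Num.Theory.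

Local Open Scope classical_set_scope.
Local Open Scope ring_scope.
Local Open Scope ereal_scope.

(** For real [c] this holds because scaling commutes with infima.
    Multiplication by [+oo] does not (a set of positive reals may have infimum
    [0]), so for [c = +oo] the positivity of the infimum is what makes
    [c * inf S = +oo]. *)
Lemma le_mule_ereal_inf (R : realType) (S : set (\bar R)) (a c : \bar R) :
  0 < c -> 0 < ereal_inf S -> (forall y, S y -> a <= c * y) ->
  a <= c * ereal_inf S.
Proof.
case: c => [c | |//] c_gt0 inf_gt0 le_a; last by rewrite gt0_mulye ?leey.
rewrite -ereal_inf_pZl//; apply: le_ereal_inf_tmp => _ [y Sy <-].
exact: le_a.
Qed.

Section MultiplicityDistance.
Variables (R : realType) (C : category) (m : multiplicity R C).
Implicit Types X Y Z : C.

Lemma mult_inf_le X Y (f : Defs.hom X Y) : mult_inf m X Y <= m X Y f.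
Proof. by apply: ge_ereal_inf; exists (m X Y f) => //; exists f. Qed.

Lemma mult_inf_ge1 X Y : 1 <= mult_inf m X Y.
Proof. by apply: le_ereal_inf_tmp => _ [f _ <-]; exact: mult_ge1. Qed.

Lemma mult_inf_gt0 X Y : 0 < mult_inf m X Y.
Proof. exact: lt_le_trans lte01 (mult_inf_ge1 X Y). Qed.

Lemma mult_inf_id X : mult_inf m X X = 1.
Proof.
apply/eqP; rewrite eq_le mult_inf_ge1 andbT.
by rewrite -(mult_id m X); exact: mult_inf_le.
Qed.

(** The infima over morphisms [X -> Y] and [Y -> Z] are taken one at a time, since
    [mult_inf m X Z <= m f * m g] holds for all [f] and [g]. *)
Lemma mult_inf_triangle X Y Z :
  mult_inf m X Z <= mult_inf m X Y * mult_inf m Y Z.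
Proof.
apply: le_mule_ereal_inf; [exact: mult_inf_gt0 | exact: mult_inf_gt0 |].
move=> _ [g _ <-]; rewrite muleC.
apply: le_mule_ereal_inf; [| exact: mult_inf_gt0 |].
  exact: lt_le_trans lte01 (mult_ge1 m g).
move=> _ [f _ <-]; rewrite muleC.
exact: le_trans (mult_inf_le (compm g f)) (mult_comp m f g).
Qed.

Lemma mult_inf_sym_gt0 X Y : 0 < mult_inf m X Y * mult_inf m Y X.
Proof. by rewrite mule_gt0 ?mult_inf_gt0. Qed.

Lemma mult_dist_fin_num X Y :
  finite_multiplicity_property m -> mult_dist m X Y \is a fin_num.
Proof.
move=> hm.
have inf_fin U V : mult_inf m U V \is a fin_num.
  by rewrite gt0_fin_numE ?mult_inf_gt0// ltey; exact/eqP/hm.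
have prod_fin : mult_inf m X Y * mult_inf m Y X \is a fin_num.
  by rewrite fin_numM.
have := mult_inf_sym_gt0 X Y; rewrite /mult_dist -(fineK prod_fin) lte_fin.
by move=> prod_gt0; rewrite lne_EFin.
Qed.

Lemma mult_dist_ge0 X Y : 0 <= mult_dist m X Y.
Proof.
rewrite lne_ge0 -[leLHS]mule1.
by apply: lee_pmul; rewrite ?lee01 ?mult_inf_ge1.
Qed.

Lemma mult_dist_refl X : mult_dist m X X = 0.
Proof. by rewrite /mult_dist mult_inf_id mule1 lne1. Qed.

Lemma mult_dist_sym X Y : mult_dist m X Y = mult_dist m Y X.
Proof. by rewrite /mult_dist muleC. Qed.

Lemma mult_dist_triangle X Y Z :
  mult_dist m X Z <= mult_dist m X Y + mult_dist m Y Z.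
Proof.
rewrite /mult_dist -lneM ?in_itv/= ?mult_inf_sym_gt0 ?leey//.
rewrite lee_lne ?in_itv/= ?leey ?andbT ?mule_ge0 ?(ltW (mult_inf_gt0 _ _))//.
(* Group the two legs from X to Z against the two legs from Z to X. *)
rewrite muleACA [mult_inf m Y X * _]muleC.
by apply: lee_pmul; rewrite ?(ltW (mult_inf_gt0 _ _)) ?mult_inf_triangle.
Qed.

End MultiplicityDistance.

Theorem proposition1p3 (R : realType) (C : category) (m : multiplicity R C)
    (hm : finite_multiplicity_property m) :
  pseudo_distance (mult_dist m).
Proof.
split.
- by move=> X Y; exact: mult_dist_fin_num.
- exact: mult_dist_ge0.
- exact: mult_dist_refl.
- exact: mult_dist_sym.
- exact: mult_dist_triangle.
Qed.
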